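(* Let $\bar A$ specify a random graph with independent edges satisfying $(\epsilon,\delta)$-concentration for some $\epsilon,\delta\in(0,1)$, and let $\beta>0$ and $b\in\mathbb{R}^n_{\ge0}$. Then with probability at least $1-\delta$ over the draw of $A$ from $\bar A$, the following holds: if the spectral radius of $A$ is less than $1/\beta$, then there is $C_0$ such that for every budget $C\ge C_0$ the intervention $y=\sqrt C\,v_1(\bar A)$ has competitive ratio $W(y)/W(y^* )\ge1-\epsilon$ in the network game on $A$.
   Context: Random graph with independent edges: given a symmetric $\bar A\in[0,1]^{n\times n}$, a graph with adjacency matrix $A$ is sampled by including each edge $\{i,j\}$ independently with probability $\bar A_{ij}$. $v_1(\bar A)$ is the unit eigenvector for the largest eigenvalue $\lambda_1(\bar A)$, with the sign chosen to have nonnegative entries. The inverted spectral gap of $\bar A$ is the smallest $\kappa$ with $|\lambda_i(\bar A)|\le\kappa\lambda_1(\bar A)$ for all $i>1$. $\bar A$ satisfies $(\epsilon,\delta)$-concentration if: (1) the maximum expected degree $d_{\max}=\max_i\sum_j\bar A_{ij}$ is at least $\frac49\log(2n/\delta)$; (2) the inverted spectral gap of $\bar A$ is at most $\kappa$ for some $\kappa<1$; (3) $\lambda_1(\bar A)(1-\kappa^2)\ge\frac{1024\sqrt{d_{\max}\log(2n/\delta)}}{\epsilon^2}$. Network game: agent $i$ has utility $u_i(a)=b_ia_i-\tfrac12a_i^2+\beta\sum_jA_{ij}a_ia_j$; $M=I-\beta A$; an intervention $y$ replaces $b$ by $b+y$ and yields equilibrium welfare $W(y)=\tfrac12\|M^{-1}(b+y)\|^2$;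 the optimal intervention of budget $C$ is $y^*\in\arg\max_{\|x\|=\sqrt C}W(x)$; the competitive ratio of $y$ is $W(y)/W(y^* )$. *)

(* Defs.v *)
From HB Require Import structures.
From mathcomp Require Import all_boot all_order all_algebra.
From mathcomp Require Import boolp reals exp.
Set Implicit Arguments. Unset Strict Implicit. Unset Printing Implicit Defensive.
Import Order.TTheory GRing.Theory Num.Theory.
Local Open Scope ring_scope.

Section Defs.
Variable R : realType.
Variable n : nat.

Definition sqnorm (v : 'cV[R]_n) : R := \sum_i (v i 0) ^+ 2.
Definition vnorm (v : 'cV[R]_n) : R := Num.sqrt (sqnorm v).

Definition edge_prob_matrix (Abar : 'M[R]_n) : Prop :=
  Abar^T = Abar /\ forall i j, 0 <= Abar i j <= 1.

(* Outcomes of the random graph: one bit per ordered pair; only pairs (i,j)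
   with i <= j are random, the others are forced to false (weight 0). *)
Definition outcome := {ffun 'I_n * 'I_n -> bool}.

Definition outcome_weight (Abar : 'M[R]_n) (w : outcome) : R :=
  \prod_(p : 'I_n * 'I_n)
    (if (p.1 <= p.2)%N then (if w p then Abar p.1 p.2 else 1 - Abar p.1 p.2)
     else (if w p then 0 else 1)).

Definition adjmx (w : outcome) : 'M[R]_n :=
  \matrix_(i, j) (if w (if (i <= j)%N then (i, j) else (j, i)) then 1 else 0).

Definition prob_graph (Abar : 'M[R]_n) (E : 'M[R]_n -> Prop) : R :=
  \sum_(w : outcome | `[< E (adjmx w) >]) outcome_weight Abar w.

Definition dmax (Abar : 'M[R]_n) : R := \big[Num.max/0]_i \sum_j Abar i j.

Definition top_eigenpair (Abar : 'M[R]_n) (lam1 : R) (v1 : 'cV[R]_n) : Prop :=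
  Abar *m v1 = lam1 *: v1 /\ vnorm v1 = 1 /\ (forall i, 0 <= v1 i 0) /\
  (forall (mu : R) (v : 'cV[R]_n), v != 0 -> Abar *m v = mu *: v -> mu <= lam1).

(* the inverted spectral gap of Abar is at most kappa: writing the eigenvalues
   (with multiplicity) as lam1 = lambda_1, lambda_2, ..., lambda_n, one has
   |lambda_i| <= kappa * lam1 for all i > 1 *)
Definition inv_spectral_gap_le (Abar : 'M[R]_n) (lam1 kappa : R) : Prop :=
  exists s : seq R,
    char_poly Abar = \prod_(x <- lam1 :: s) ('X - x%:P) /\
    (forall x, x \in s -> `|x| <= kappa * lam1).

Definition concentration (Abar : 'M[R]_n) (lam1 eps delta : R) : Prop :=
  dmax Abar >= 4 / 9 * ln (2 * n%:R / delta) /\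
  exists kappa : R, 0 <= kappa /\ kappa < 1 /\
    inv_spectral_gap_le Abar lam1 kappa /\
    lam1 * (1 - kappa ^+ 2) >=
      1024 * Num.sqrt (dmax Abar * ln (2 * n%:R / delta)) / eps ^+ 2.

(* spectral radius of A is less than r (A symmetric: all eigenvalues real) *)
Definition spectral_radius_lt (A : 'M[R]_n) (r : R) : Prop :=
  forall (mu : R) (v : 'cV[R]_n), v != 0 -> A *m v = mu *: v -> `|mu| < r.

Definition Mgame (beta : R) (A : 'M[R]_n) : 'M[R]_n := 1%:M - beta *: A.

Definition welfare (beta : R) (A : 'M[R]_n) (b y : 'cV[R]_n) : R :=
  1 / 2 * sqnorm (invmx (Mgame beta A) *m (b + y)).

Definition optimal_intervention (beta : R) (A : 'M[R]_n) (b : 'cV[R]_n)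
    (C : R) (ystar : 'cV[R]_n) : Prop :=
  vnorm ystar = Num.sqrt C /\
  forall x : 'cV[R]_n, vnorm x = Num.sqrt C ->
    welfare beta A b x <= welfare beta A b ystar.

Definition competitive_ratio (beta : R) (A : 'M[R]_n) (b y ystar : 'cV[R]_n) : R :=
  welfare beta A b y / welfare beta A b ystar.

End Defs.

(* Main.v *)
Require Import Defs.
From HB Require Import structures.
From mathcomp Require Import all_boot all_order all_algebra.
From mathcomp Require Import ring lra.
From mathcomp Require Import boolp classical_sets reals topology normedtype.
From mathcomp Require Import sequences derive exp.
Import Order.TTheory GRing.Theory Num.Theory numFieldNormedType.Exports.
Local Open Scope ring_scope.

(** The trace moment method bounds [B = A - Abar]: expanding [B ^+ m], the mean of
    a product of centred edge variables vanishes as soon as one edge occurs once,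
    so only walks with at most [m / 2] distinct edges count.  Weighting each new
    edge by [theta * p_e] with [theta <= 1], a walk that has already used [s] edges
    continues with total weight at most [s + theta * d], whence
      [E (tr (B ^+ (2 * p))) <= n * (theta^-1 * (2 * p + theta * d) ^+ 2) ^+ p].
    With [theta * d] and [p] of order [L = ln (2 * n / delta)] and [p] a power of
    two, Markov's inequality gives [|x^T B x| <= 32 * sqrt (d * L)] for all unit
    [x] with probability at least [1 - delta].  Comparing Rayleigh quotients, the
    top eigenvector [u] of [A] then satisfies [1 - <u, v1> ^+ 2 < eps].  Finally
    [|M^-1 x|] lies between [|<u, x>| / (1 - beta * mu)] and
    [|x| / (1 - beta * mu)], so the competitive ratio is bounded below by a
    quantity tending to [<u, v1> ^+ 2] as the budget grows. *)

(** * Euclidean vectors and quadratic forms *)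

Definition dotv {R : realType} {n} (u v : 'cV[R]_n) : R := \sum_i u i 0 * v i 0.

Lemma dotvE {R : realType} {n} (u v : 'cV[R]_n) : dotv u v = (u^T *m v) 0 0.
Proof. by rewrite mxE; apply: eq_bigr => i _; rewrite mxE. Qed.

Lemma dotvv {R : realType} {n} (u : 'cV[R]_n) : dotv u u = sqnorm u.
Proof. by apply: eq_bigr => i _; rewrite expr2. Qed.

Lemma dotvC {R : realType} {n} (u v : 'cV[R]_n) : dotv u v = dotv v u.
Proof. by apply: eq_bigr => i _; rewrite mulrC. Qed.

Lemma dotvDr {R : realType} {n} (u v w : 'cV[R]_n) :
  dotv u (v + w) = dotv u v + dotv u w.
Proof. by rewrite !dotvE mulmxDr mxE. Qed.

Lemma dotvZr {R : realType} {n} (u v : 'cV[R]_n) a : dotv u (a *: v) = a * dotv u v.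
Proof. by rewrite !dotvE -scalemxAr mxE. Qed.

Lemma dotvDl {R : realType} {n} (u v w : 'cV[R]_n) :
  dotv (v + w) u = dotv v u + dotv w u.
Proof. by rewrite dotvC dotvDr !(dotvC u). Qed.

Lemma dotvZl {R : realType} {n} (u v : 'cV[R]_n) a : dotv (a *: v) u = a * dotv v u.
Proof. by rewrite dotvC dotvZr dotvC. Qed.

Lemma dotvBr {R : realType} {n} (u v w : 'cV[R]_n) :
  dotv u (v - w) = dotv u v - dotv u w.
Proof. by rewrite dotvDr -scaleN1r dotvZr mulN1r. Qed.

Lemma dotv0 {R : realType} {n} (u : 'cV[R]_n) : dotv u 0 = 0.
Proof. by rewrite dotvE mulmx0 mxE. Qed.

Lemma dotv_mulmx {R : realType} {n} (A : 'M[R]_n) (u v : 'cV[R]_n) :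
  dotv u (A *m v) = dotv (A^T *m u) v.
Proof. by rewrite !dotvE trmx_mul trmxK mulmxA. Qed.

Lemma sqnorm_ge0 {R : realType} {n} (u : 'cV[R]_n) : 0 <= sqnorm u.
Proof. by apply: sumr_ge0 => i _; rewrite sqr_ge0. Qed.

Lemma sqnorm_eq0 {R : realType} {n} (u : 'cV[R]_n) : (sqnorm u == 0) = (u == 0).
Proof.
apply/idP/eqP => [|->]; last by rewrite -dotvv dotv0.
rewrite psumr_eq0 => [/allP u0|i _]; last exact: sqr_ge0.
apply/matrixP => i j; rewrite ord1 mxE; apply/eqP.
by rewrite -sqrf_eq0; apply: (implyP (u0 i _)); rewrite ?mem_index_enum.
Qed.

Lemma sqnormZ {R : realType} {n} (u : 'cV[R]_n) a : sqnorm (a *: u) = a ^+ 2 * sqnorm u.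
Proof. by rewrite -!dotvv dotvZl dotvZr mulrA expr2. Qed.

Lemma vnorm_ge0 {R : realType} {n} (u : 'cV[R]_n) : 0 <= vnorm u.
Proof. exact: sqrtr_ge0. Qed.

Lemma vnorm_sqr {R : realType} {n} (u : 'cV[R]_n) : vnorm u ^+ 2 = sqnorm u.
Proof. by rewrite sqr_sqrtr ?sqnorm_ge0. Qed.

Lemma cauchy_schwarz {R : realType} {n} (u v : 'cV[R]_n) :
  dotv u v ^+ 2 <= sqnorm u * sqnorm v.
Proof.
have [/eqP|v0] := eqVneq (sqnorm v) 0.
  by rewrite sqnorm_eq0 => /eqP ->; rewrite dotv0 expr0n mulr_ge0 ?sqnorm_ge0.
have vp : 0 < sqnorm v by rewrite lt_def v0 sqnorm_ge0.
(* This vector is the component of [u] orthogonal to [v], scaled by [sqnorm v] to avoid a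
   division. *)
have := sqnorm_ge0 (sqnorm v *: u - dotv u v *: v).
rewrite -dotvv !(dotvDl, dotvDr, dotvBr) -!scaleNr !(dotvDl, dotvDr, dotvBr, dotvZl, dotvZr).
rewrite !dotvv (dotvC v u) => h.
rewrite -(ler_pM2r vp) -subr_ge0; move: h; congr (_ <= _); ring.
Qed.

Lemma dotv_le_vnorm {R : realType} {n} (u v : 'cV[R]_n) :
  `|dotv u v| <= vnorm u * vnorm v.
Proof.
rewrite -(@ler_pXn2r _ 2) ?nnegrE ?mulr_ge0 ?vnorm_ge0 //.
by rewrite real_normK ?num_real // exprMn !vnorm_sqr cauchy_schwarz.
Qed.

Lemma sqnormD {R : realType} {n} (u v : 'cV[R]_n) :
  sqnorm (u + v) = sqnorm u + 2 * dotv u v + sqnorm v.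
Proof. by rewrite -!dotvv dotvDl !dotvDr (dotvC v u); ring. Qed.

Lemma vnormD {R : realType} {n} (u v : 'cV[R]_n) : vnorm (u + v) <= vnorm u + vnorm v.
Proof.
rewrite -(@ler_pXn2r _ 2) ?nnegrE ?addr_ge0 ?vnorm_ge0 //.
rewrite vnorm_sqr sqnormD -!vnorm_sqr.
have := le_trans (ler_norm _) (dotv_le_vnorm u v); lra.
Qed.

Lemma trmxX {R : realType} {n} (A : 'M[R]_n) k : A^T = A -> (A ^+ k)^T = A ^+ k.
Proof.
move=> sA; elim: k => [|k IH]; first by rewrite !expr0 trmx1.
by rewrite exprS -mulmxE trmx_mul IH sA mulmxE -exprSr exprS.
Qed.

(* Cauchy-Schwarz squares the power of the matrix at each step; the last factor
   is bounded by its Frobenius norm. *)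
Lemma quadratic_form_le_trace {R : realType} {n} (B : 'M[R]_n) (u : 'cV[R]_n) k :
  B^T = B -> vnorm u = 1 ->
  dotv u (B *m u) ^+ (2 ^ k.+1) <= \tr (B ^+ (2 ^ k.+1)).
Proof.
move=> sB u1; have su : sqnorm u = 1 by rewrite -vnorm_sqr u1 expr1n.
have form_sqr j : dotv u (B ^+ j *m u) ^+ 2 <= sqnorm (B ^+ j *m u).
  by apply: le_trans (cauchy_schwarz _ _) _; rewrite su mul1r.
have normE j : sqnorm (B ^+ j *m u) = dotv u (B ^+ (j * 2) *m u).
  rewrite -dotvv -{1}(trmxX _ j sB) -dotv_mulmx.
  by rewrite mulmxA mulmxE -exprD addnn muln2.
have step : `|dotv u (B *m u)| ^+ (2 ^ k) <= `|dotv u (B ^+ (2 ^ k) *m u)|.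
  elim: k => [|k IH]; first by rewrite !expr1.
  rewrite expnSr exprM -normE (ger0_norm (sqnorm_ge0 _)).
  apply: le_trans (form_sqr _); rewrite -[leRHS]real_normK ?num_real //.
  by rewrite ler_pXn2r ?nnegrE ?exprn_ge0.
rewrite expnSr exprM.
apply: (@le_trans _ _ (sqnorm (B ^+ (2 ^ k) *m u))).
  apply: le_trans (form_sqr _); rewrite -[leRHS]real_normK ?num_real //.
  rewrite -[leLHS]real_normK ?num_real // normrX.
  by rewrite ler_pXn2r ?nnegrE ?exprn_ge0.
rewrite exprM expr2 -mulmxE; set C := B ^+ _.
have sC : C^T = C by exact: trmxX.
rewrite -{3}sC /sqnorm /mxtrace.
apply: ler_sum => i _; rewrite !mxE; under [leRHS]eq_bigr do rewrite mxE -expr2.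
have -> : \sum_j C i j * u j 0 = dotv (row i C)^T u.
  by apply: eq_bigr => j _; rewrite !mxE.
have -> : \sum_j C i j ^+ 2 = sqnorm (row i C)^T.
  by apply: eq_bigr => j _; rewrite !mxE.
by apply: le_trans (cauchy_schwarz _ _) _; rewrite su mulr1.
Qed.

Lemma quadratic_form_continuous {R : realType} {n} (A : 'M[R]_n) :
  continuous (fun x : 'rV[R]_n => \sum_i x 0 i * (\sum_j A i j * x 0 j)).
Proof.
have cont_coord j : continuous (fun x : 'rV[R]_n => x 0 j) by exact: coord_continuous.
have contM (f g : 'rV[R]_n -> R) : continuous f -> continuous g ->
    continuous (fun x => f x * g x).
  by move=> cf cg x; exact: (continuousM (cf x) (cg x)).
apply: (continuous_big add_continuous) => i _; apply: (contM _ _); first exact: cont_coord.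
apply: (continuous_big add_continuous) => j _; apply: (contM _ _) => [x|].
  exact: cst_continuous.
exact: cont_coord.
Qed.

Lemma sphere_compact {R : realType} {n} :
  compact [set x : 'rV[R]_n | sqnorm x^T = 1]%classic.
Proof.
apply: bounded_closed_compact.
  exists 1; split; first exact: num_real.
  move=> M M1 x /= x1; rewrite [leLHS]/Num.norm /= mx_normrE.
  apply: bigmax_le => [|[i j] _ /=]; first lra.
  apply: le_trans (ltW M1); rewrite ord1 -(@expr_le1 _ 2) // real_normK ?num_real //.
  rewrite -x1 /sqnorm (bigD1 j) //= mxE lerDl; apply: sumr_ge0 => k _; exact: sqr_ge0.
(* The sphere is a level set of the form of the identity matrix, so closedness follows from
   continuity of quadratic forms. *)
have -> : [set x : 'rV[R]_n | sqnorm x^T = 1]%classic =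
    ((fun x : 'rV[R]_n => \sum_i x 0 i * (\sum_j (1%:M : 'M[R]_n) i j * x 0 j))
      @^-1` [set 1])%classic.
  apply/funext => x /=; apply/propext; suff -> : sqnorm x^T =
     \sum_i x 0 i * (\sum_j (1%:M : 'M[R]_n) i j * x 0 j) by [].
  apply: eq_bigr => i _; rewrite (bigD1 i) //= big1 ?addr0 => [|j ji].
    by rewrite !mxE eqxx mul1r expr2.
  by rewrite mxE eq_sym (negbTE ji) mul0r.
apply: closed_comp => [x _|]; first exact: quadratic_form_continuous.
exact: closed_eq.
Qed.

(* First-order condition at a maximum of the form on the sphere, read off from
   the quadratic polynomial in [t] obtained at [u + t w]. *)
Lemma rayleigh_max {R : realType} {n} (A : 'M[R]_n) : (0 < n)%N -> A^T = A ->
  exists u mu, [/\ vnorm u = 1, A *m u = mu *: u &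
    forall x, dotv x (A *m x) <= mu * sqnorm x].
Proof.
move=> n0 sA.
have S0 : ([set x : 'rV[R]_n | sqnorm x^T = 1] !=set0)%classic.
  exists (delta_mx 0 (Ordinal n0)); rewrite /= /sqnorm (bigD1 (Ordinal n0)) //=.
  rewrite !mxE !eqxx expr1n big1 ?addr0 // => i ni.
  by rewrite !mxE (negbTE ni) andbF expr0n.
have cf := continuous_subspaceT (quadratic_form_continuous A).
have [c] := EVT_max_rV S0 sphere_compact (cf _).
rewrite inE /= => c1 maxc.
have formE (x : 'cV[R]_n) :
    \sum_i x^T 0 i * (\sum_j A i j * x^T 0 j) = dotv x (A *m x).
  apply: eq_bigr => i _; rewrite !mxE; congr (_ * _).
  by apply: eq_bigr => j _; rewrite !mxE.
set u := c^T in c1; set mu := dotv u (A *m u).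
have le_mu x : dotv x (A *m x) <= mu * sqnorm x.
  have [->|x0] := eqVneq x 0; first by rewrite mulmx0 -dotvv !dotv0 mulr0.
  rewrite -sqnorm_eq0 in x0.
  have xp : 0 < sqnorm x by rewrite lt_def x0 sqnorm_ge0.
  pose a := (vnorm x)^-1.
  have a2 : a ^+ 2 = (sqnorm x)^-1 by rewrite exprVn vnorm_sqr.
  have /maxc : (a *: x)^T \in [set x : 'rV[R]_n | sqnorm x^T = 1]%classic.
    by rewrite inE /= trmxK sqnormZ a2 mulVf.
  rewrite formE -[c]trmxK formE -/u -/mu -scalemxAr dotvZl dotvZr mulrA -expr2 a2.
  by rewrite mulrC ler_pdivrMr.
exists u, mu; split => //; first by rewrite /vnorm c1 sqrtr1.
apply/eqP; rewrite -subr_eq0 -sqnorm_eq0; apply/eqP.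
set w := _ - _; have wE : w = A *m u - mu *: u by []; clearbody w.
have poly t : t * (2 * sqnorm w) <= t ^+ 2 * (mu * sqnorm w - dotv w (A *m w)).
  have := le_mu (u + t *: w).
  rewrite sqnormD mulmxDr -scalemxAr !dotvDl !dotvDr !dotvZl !dotvZr sqnormZ c1.
  have -> : dotv u (A *m w) = dotv w (A *m u) by rewrite dotv_mulmx sA dotvC.
  have -> : sqnorm w = dotv w (A *m u) - mu * dotv u w.
    by rewrite -dotvv {2}wE dotvBr dotvZr (dotvC u).
  rewrite -/mu; nra.
have w0 := sqnorm_ge0 w.
set K := mu * _ - _ in poly.
apply/eqP; rewrite eq_le w0 andbT leNgt; apply/negP => wp.
have K1 : 0 < `|K| + 1 by rewrite ltr_wpDl.
(* For this [t], [t * K] is below [sqnorm w], while dividing [poly t] by [t] gives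
   [2 * sqnorm w <= t * K]. *)
pose t := sqnorm w / (`|K| + 1).
have t0 : 0 < t by rewrite divr_gt0.
have tK : t * (`|K| + 1) = sqnorm w by rewrite divfK ?gt_eqF.
have := poly t; rewrite expr2 -mulrA ler_pM2l // => le_t.
have : t * K <= t * `|K| by rewrite ler_wpM2l ?ler_norm // ltW.
lra.
Qed.

(** * Deflation *)

(** Matrix determinant lemma, from two triangular factorisations of one block matrix. The extra
    factor [c] on the left removes any division by [c], so [c] may be a polynomial. *)
Lemma det_scalar_add_outer {R : comNzRingType} {n} (u v : 'cV[R]_n) (a c : R) :
  c * \det (c%:M + a *: (u *m v^T)) = c ^+ n * (c + a * (v^T *m u) 0 0).
Proof.
pose M := block_mx (c%:M : 'M_n) (- (a *: u)) v^T (1%:M : 'M_1).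
have eL : M *m block_mx 1%:M (a *: u) 0 c%:M =
          block_mx c%:M 0 v^T (c%:M + a *: (v^T *m u)).
  rewrite mulmx_block !mulmx0 !mulmx1 !mul1mx !addr0 mul_mx_scalar mul_scalar_mx.
  by rewrite scalerN subrr -scalemxAr addrC.
have eR : M = block_mx 1%:M (- (a *: u)) 0 1%:M *m
              block_mx (c%:M + a *: (u *m v^T)) 0 v^T 1%:M.
  rewrite mulmx_block !mul0mx !mul1mx !mulmx1 !add0r /M.
  by rewrite mulNmx -scalemxAl addrK.
have := congr1 determinant eL; rewrite det_mulmx {1}eR det_mulmx.
rewrite !det_lblock !det_ublock !det1 !mul1r !mulr1 !det_scalar expr1 mulrC => ->.
by rewrite det_mx11 !mxE eqxx.
Qed.

(* [v] is an eigenvector, so [(X - A)(X - lam + lam v v^T) = (X - lam)(X - T)]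
   for the deflated matrix [T]. *)
Lemma char_poly_deflation {R : realType} {n} (A : 'M[R]_n) (lam : R) (v : 'cV[R]_n) :
  sqnorm v = 1 -> A *m v = lam *: v ->
  'X * char_poly A = ('X - lam%:P) * char_poly (A - lam *: (v *m v^T)).
Proof.
move=> v1 Av.
pose pv : 'cV[{poly R}]_n := map_mx polyC v.
have pv1 : (pv^T *m pv) 0 0 = 1.
  by rewrite /pv map_trmx -map_mxM mxE -dotvE dotvv v1.
have Xpv : char_poly_mx A *m pv = ('X - lam%:P) *: pv.
  rewrite /char_poly_mx mulmxBl mul_scalar_mx -map_mxM Av map_mxZ /= scalerBl.
  by [].
have key : char_poly_mx A *m (('X - lam%:P)%:M + lam%:P *: (pv *m pv^T))
   = ('X - lam%:P) *: char_poly_mx (A - lam *: (v *m v^T)).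
  rewrite mulmxDr mul_mx_scalar -scalemxAr mulmxA Xpv -scalemxAl.
  rewrite scalerA mulrC -scalerA -scalerDr; congr (_ *: _).
  rewrite /char_poly_mx map_mxB map_mxZ /= map_mxM map_trmx opprB addrA.
  by rewrite addrAC.
have := congr1 determinant key; rewrite det_mulmx detZ -/(char_poly A) -/(char_poly _).
set D := \det _; set cT := char_poly (_ - _) => detE.
have := det_scalar_add_outer pv pv lam%:P ('X - lam%:P).
rewrite -/D pv1 mulr1 subrK => cD.
have c0 : ('X - lam%:P) ^+ n != 0 by rewrite expf_neq0 // polyXsubC_eq0.
apply: (mulfI c0); rewrite mulrA -cD mulrCA -detE; ring.
Qed.

(* The top Rayleigh quotient of the deflated matrix is a root of its
   characteristic polynomial, hence [0] or one of the remaining eigenvalues. *)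
Lemma quadratic_form_orthogonal_le {R : realType} {n} (A : 'M[R]_n) (lam kappa : R)
    (v x : 'cV[R]_n) :
  A^T = A -> vnorm v = 1 -> A *m v = lam *: v -> 0 <= kappa * lam ->
  inv_spectral_gap_le A lam kappa -> dotv v x = 0 ->
  dotv x (A *m x) <= kappa * lam * sqnorm x.
Proof.
move=> sA v1 Av kl0 [s [chiA gap]] vx.
have sv : sqnorm v = 1 by rewrite -vnorm_sqr v1 expr1n.
have n0 : (0 < n)%N.
  case: n v sv {A sA v1 Av x vx chiA} => // v /eqP.
  by rewrite /sqnorm big_ord0 eq_sym oner_eq0.
pose T := A - lam *: (v *m v^T).
have sT : T^T = T by rewrite /T linearB linearZ /= trmx_mul trmxK sA.
have [u [mu [u1 Tu le_mu]]] := rayleigh_max T n0 sT.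
have Tx : T *m x = A *m x.
  rewrite mulmxBl -scalemxAl -mulmxA [v^T *m x]mx11_scalar -dotvE vx.
  by rewrite mul_mx_scalar scale0r scaler0 subr0.
rewrite -Tx; apply: le_trans (le_mu x) _; rewrite ler_wpM2r ?sqnorm_ge0 //.
have chiT : char_poly T = \prod_(y <- 0 :: s) ('X - y%:P).
  have := char_poly_deflation A lam v sv Av.
  rewrite chiA !big_cons subr0 mulrCA => /mulfI -> //.
  by rewrite polyXsubC_eq0.
have : root (char_poly T) mu.
  rewrite -eigenvalue_root_char; apply/eigenvalueP; exists u^T.
    by rewrite -sT -trmx_mul Tu linearZ.
  by rewrite trmx_eq0 -sqnorm_eq0 -vnorm_sqr u1 expr1n oner_eq0.
rewrite chiT root_prod_XsubC inE => /orP[/eqP -> //|/gap].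
exact: le_trans (ler_norm _).
Qed.

(** * Moments of the centred adjacency matrix *)

(** The ordered representative of an unordered pair, at which [adjmx] reads its bit. *)
Definition pair_of {n} (x y : 'I_n) : 'I_n * 'I_n :=
  if (x <= y)%N then (x, y) else (y, x).

Definition edge_weight {R : realType} {n} (Abar : 'M[R]_n) (e : 'I_n * 'I_n)
    (a : bool) : R :=
  if (e.1 <= e.2)%N then (if a then Abar e.1 e.2 else 1 - Abar e.1 e.2)
  else (if a then 0 else 1).

Definition edge_dev {R : realType} {n} (Abar : 'M[R]_n) (e : 'I_n * 'I_n)
    (a : bool) : R := a%:R - Abar e.1 e.2.

Definition expect {R : realType} {n} (Abar : 'M[R]_n) (f : outcome n -> R) : R :=
  \sum_w outcome_weight Abar w * f w.

Lemma pair_of_le {n} (x y : 'I_n) : ((pair_of x y).1 <= (pair_of x y).2)%N.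
Proof. by rewrite /pair_of; case: (leqP x y) => [|/ltnW]. Qed.

Lemma pair_of_inj {n} (x : 'I_n) : injective (pair_of x).
Proof.
move=> y z; rewrite /pair_of; case: leqP => h1; case: leqP => h2 [] //.
- by move=> <- ->.
- by move=> -> <-.
Qed.

Lemma pair_ofE {R : realType} {n} (Abar : 'M[R]_n) (x y : 'I_n) :
  Abar^T = Abar -> Abar (pair_of x y).1 (pair_of x y).2 = Abar x y.
Proof. by move=> sA; rewrite /pair_of; case: leqP => //= _; rewrite -{1}sA mxE. Qed.

Lemma adjmx_subE {R : realType} {n} (Abar : 'M[R]_n) (w : outcome n) x y :
  Abar^T = Abar ->
  (adjmx R w - Abar) x y = edge_dev Abar (pair_of x y) (w (pair_of x y)).
Proof.
by move=> sA; rewrite !mxE /edge_dev pair_ofE // -/(pair_of x y); case: (w _).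
Qed.

Lemma outcome_weight_ge0 {R : realType} {n} (Abar : 'M[R]_n) (w : outcome n) :
  edge_prob_matrix Abar -> 0 <= outcome_weight Abar w.
Proof.
move=> [_ A01]; apply: prodr_ge0 => e _; have := A01 e.1 e.2.
by do 2?case: ifP => _; lra.
Qed.

(** Independence of the edges: the weight is a product over pairs, so a sum over all outcomes
    distributes into one sum per pair. *)
Lemma expect_prod {R : realType} {n} (Abar : 'M[R]_n)
    (f : 'I_n * 'I_n -> bool -> R) :
  expect Abar (fun w => \prod_e f e (w e))
  = \prod_e \sum_(a : bool) edge_weight Abar e a * f e a.
Proof.
rewrite bigA_distr_bigA /expect; apply: eq_bigr => w _.
by rewrite /outcome_weight -big_split.
Qed.

Lemma expect1 {R : realType} {n} (Abar : 'M[R]_n) : expect Abar (fun=> 1) = 1.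
Proof.
have := expect_prod Abar (fun _ _ => 1); under [X in X = _ -> _]eq_bigr do rewrite big1 //.
rewrite -/(expect Abar (fun=> 1)) => ->; rewrite big1 // => e _.
rewrite big_bool /edge_weight /=.
by case: ifP => _; rewrite !mulr1; ring.
Qed.

(** With [p] the edge probability, powers beyond the second only shrink the terms, and the variance
    is [p * (1 - p) <= p]. *)
Lemma edge_moment_le {R : realType} {n} (Abar : 'M[R]_n) (e : 'I_n * 'I_n) k :
  0 <= Abar e.1 e.2 <= 1 -> (e.1 <= e.2)%N -> (1 < k)%N ->
  `|\sum_(a : bool) edge_weight Abar e a * edge_dev Abar e a ^+ k|
    <= Abar e.1 e.2.
Proof.
move=> /andP[p0 p1] le_e k1.
rewrite big_bool /edge_weight /edge_dev le_e /=; set p := Abar _ _ in p0 p1 *.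
rewrite sub0r mulr1n (le_trans (ler_normD _ _)) // !normrM !normrX normrN.
rewrite !ger0_norm ?subr_ge0 //; case: k k1 => [|[|k]] // _; rewrite !exprS.
have h1 : (1 - p) ^+ k <= 1 by rewrite exprn_ile1 //; lra.
have h2 : p ^+ k <= 1 by rewrite exprn_ile1 //; lra.
have q0 : 0 <= 1 - p by lra.
have g1 : p * ((1 - p) * ((1 - p) * (1 - p) ^+ k)) <= p * ((1 - p) * (1 - p)).
  by do 2![apply: ler_wpM2l => //]; rewrite ler_piMr.
have g2 : (1 - p) * (p * (p * p ^+ k)) <= (1 - p) * (p * p).
  by do 2![apply: ler_wpM2l => //]; rewrite ler_piMr.
apply: le_trans (lerD g1 g2) _.
nra.
Qed.

Lemma edge_moment1 {R : realType} {n} (Abar : 'M[R]_n) (e : 'I_n * 'I_n) :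
  (e.1 <= e.2)%N -> \sum_(a : bool) edge_weight Abar e a * edge_dev Abar e a = 0.
Proof.
by move=> le_e; rewrite big_bool /edge_weight /edge_dev le_e /=; ring.
Qed.

(** The multiplicities of the distinct elements add up to [size s], and each is at least two. *)
Lemma size_undup_half {T : eqType} (s : seq T) p :
  (size s <= p.*2)%N -> (forall e, e \in s -> (1 < count_mem e s)%N) ->
  (size (undup s) <= p)%N.
Proof.
move=> ss mult; rewrite -leq_double; apply: leq_trans ss.
have <- : sumn [seq count_mem e s | e <- undup s] = size s.
  by have := perm_count_undup s => /perm_size; rewrite size_flatten /shape -map_comp => <-;
     congr sumn; apply: eq_map => e /=; rewrite size_nseq.
rewrite sumnE big_map -muln2 mulnC -sum1_size big_distrr /=.
by rewrite big_seq [X in (_ <= X)%N]big_seq; apply: leq_sum => e; rewrite mem_undup => /mult.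
Qed.

(** [undup] charges each edge only at its first use; repeated uses are free. *)
Definition trail_weight {R : realType} {n} (Abar : 'M[R]_n) (theta : R)
    (s : seq ('I_n * 'I_n)) : R :=
  \prod_(e <- undup s) (theta * Abar e.1 e.2).

Lemma trail_weight_ge0 {R : realType} {n} (Abar : 'M[R]_n) (theta : R) s :
  edge_prob_matrix Abar -> 0 < theta -> 0 <= trail_weight Abar theta s.
Proof.
move=> [_ A01] /ltW t0; apply: prodr_ge0 => e _.
by rewrite mulr_ge0 //; case/andP: (A01 e.1 e.2).
Qed.

(* A monomial in which some edge occurs once has mean zero; in the others at
   most half of the edges are distinct, and [theta <= 1] turns that bound on
   the number of factors into a multiplicative weight. *)
Lemma expect_edge_devs_le {R : realType} {n} (Abar : 'M[R]_n) (theta : R) p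
    (s : seq ('I_n * 'I_n)) :
  edge_prob_matrix Abar -> 0 < theta <= 1 -> (size s <= p.*2)%N ->
  (forall e, e \in s -> (e.1 <= e.2)%N) ->
  `|expect Abar (fun w => \prod_(e <- s) edge_dev Abar e (w e))|
  <= theta^-1 ^+ p * trail_weight Abar theta s.
Proof.
move=> /[dup] HA [_ A01] /andP[t0 t1] ss les.
have -> : expect Abar (fun w => \prod_(e <- s) edge_dev Abar e (w e)) =
    \prod_e \sum_(a : bool)
       edge_weight Abar e a * edge_dev Abar e a ^+ count_mem e s.
  rewrite -(expect_prod Abar (fun e a => edge_dev Abar e a ^+ count_mem e s)).
  apply: eq_bigr => w _; congr (_ * _).
  rewrite -prodr_undup_exp_count big_uniq ?undup_uniq //=.
  rewrite [RHS](bigID (mem (undup s))) /= [X in _ * X]big1 ?mulr1 //.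
  move=> e; rewrite mem_undup => /count_memPn ->; exact: expr0.
have rhs0 := trail_weight_ge0 Abar theta s HA t0.
have [/existsP[e /andP[es /eqP e1]]|] :=
    boolP [exists e, (e \in s) && (count_mem e s == 1%N)].
  rewrite (bigD1 e) //= e1 edge_moment1 ?les // mul0r normr0.
  by rewrite mulr_ge0 // exprn_ge0 // invr_ge0 ltW.
rewrite negb_exists => /forallP nomult.
have mult e : e \in s -> (1 < count_mem e s)%N.
  move=> es; have := nomult e; rewrite es /= => ne1.
  have : (0 < count_mem e s)%N by rewrite -has_count has_pred1.
  by case: (count_mem e s) ne1 => [|[]].
(* A pair absent from [s] contributes the total mass of its bit, which is one. *)
rewrite normr_prod (bigID (mem (undup s))) /= [X in _ * X]big1 ?mulr1; last first.
  move=> e; rewrite mem_undup => /count_memPn ->.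
  under eq_bigr do rewrite expr0 mulr1.
  rewrite big_bool /edge_weight /=; case: ifP => _; last by rewrite add0r normr1.
  by rewrite addrCA subrr addr0 normr1.
rewrite -(big_uniq _ (undup_uniq s)) /=.
apply: (@le_trans _ _ (\prod_(e <- undup s) Abar e.1 e.2)).
  rewrite [leLHS]big_seq [leRHS]big_seq; apply: ler_prod => e; rewrite mem_undup => es.
  by rewrite normr_ge0 /= edge_moment_le ?mult ?les.
rewrite /trail_weight big_split /= big_const_seq count_predT iter_mulr_1.
rewrite mulrA ler_peMl ?prodr_ge0 //; first by move=> e _; case/andP: (A01 e.1 e.2).
(* One factor [theta^-1] cancels the [theta] of each distinct edge; the surplus power of [theta^-1]
   is at least one. *)
rewrite -(subnK (size_undup_half _ _ ss mult)) exprD -mulrA -exprMn mulVf ?gt_eqF //.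
by rewrite expr1n mulr1 exprn_ege1 // invf_ge1.
Qed.

Lemma degree_le_dmax {R : realType} {n} (Abar : 'M[R]_n) x :
  \sum_y Abar x y <= dmax Abar.
Proof. exact: (le_bigmax _ (fun x => \sum_y Abar x y)). Qed.

(** From [x], at most [size s] neighbours reuse an edge, since [pair_of x] is injective, and each
    leaves the weight unchanged. New edges cost [theta * Abar x y], with sum at most
    [theta * dmax Abar]. *)
Lemma sum_trail_weight_le {R : realType} {n} (Abar : 'M[R]_n) (theta : R) x s :
  edge_prob_matrix Abar -> 0 < theta ->
  \sum_y trail_weight Abar theta (pair_of x y :: s)
    <= ((size s)%:R + theta * dmax Abar) * trail_weight Abar theta s.
Proof.
move=> /[dup] HA [sA A01] t0; have w0 := trail_weight_ge0 Abar theta s HA t0.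
apply: (@le_trans _ _ (\sum_y ((pair_of x y \in s)%:R + theta * Abar x y)
                        * trail_weight Abar theta s)).
  apply: ler_sum => y _; rewrite /trail_weight /=.
  have p0 : 0 <= theta * Abar x y by case/andP: (A01 x y) => ? _; rewrite mulr_ge0 // ltW.
  case: ifP => _; first by rewrite ler_peMl // lerDl.
  by rewrite big_cons pair_ofE // add0r.
rewrite -mulr_suml ler_wpM2r // big_split /= -mulr_sumr lerD //; last first.
  by rewrite ler_wpM2l ?degree_le_dmax // ltW.
rewrite -natr_sum ler_nat -big_mkcond /= sum1_card -(size_image (pair_of x)).
apply: uniq_leq_size; first by rewrite map_inj_uniq ?enum_uniq //; exact: pair_of_inj.
by move=> e /fintype.imageP[y ys ->].
Qed.

(** Induction on the remaining steps [m], with [s] recording the edges already walked. Since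
    [size s + m] stays [p.*2], one factor bounds every step. *)
Lemma expect_walk_le {R : realType} {n} (Abar : 'M[R]_n) (theta : R) p m
    (s : seq ('I_n * 'I_n)) (x z : 'I_n) :
  edge_prob_matrix Abar -> 0 < theta <= 1 -> (size s + m = p.*2)%N ->
  (forall e, e \in s -> (e.1 <= e.2)%N) ->
  expect Abar (fun w => (\prod_(e <- s) edge_dev Abar e (w e))
                        * ((adjmx R w - Abar) ^+ m) x z)
  <= theta^-1 ^+ p * trail_weight Abar theta s
     * (p.*2%:R + theta * dmax Abar) ^+ m.
Proof.
move=> HA /[dup] /andP[t0 t1] Ht; elim: m s x => [|m IH] s x ss les.
  have := expect_edge_devs_le Abar theta p s HA Ht; rewrite addn0 in ss.
  rewrite ss leqnn => /(_ isT les) le_s.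
  rewrite expr0 mulr1; apply: le_trans le_s; rewrite /expect.
  under [leLHS]eq_bigr do rewrite expr0 mxE.
  case: eqP => _; last first.
    by rewrite big1 ?normr_ge0 // => w _; rewrite !mulr0.
  by under [leLHS]eq_bigr do rewrite mulr1; exact: ler_norm.
have -> : expect Abar (fun w => (\prod_(e <- s) edge_dev Abar e (w e))
                        * ((adjmx R w - Abar) ^+ m.+1) x z) =
  \sum_y expect Abar (fun w =>
     (\prod_(e <- pair_of x y :: s) edge_dev Abar e (w e))
     * ((adjmx R w - Abar) ^+ m) y z).
  rewrite /expect exchange_big /=; apply: eq_bigr => w _.
  rewrite exprS mxE !mulr_sumr; apply: eq_bigr => y _.
  by rewrite big_cons adjmx_subE; [ring | case: HA].
have d0 : 0 <= p.*2%:R + theta * dmax Abar.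
  by rewrite addr_ge0 // mulr_ge0 // ?bigmax_ge_id // ltW.
have c0 : 0 <= theta^-1 ^+ p by rewrite exprn_ge0 // invr_ge0 ltW.
apply: (@le_trans _ _ (\sum_y theta^-1 ^+ p * trail_weight Abar theta (pair_of x y :: s)
    * (p.*2%:R + theta * dmax Abar) ^+ m)).
  apply: ler_sum => y _; apply: IH; first by rewrite /= addSnnS.
  by move=> e; rewrite inE => /orP[/eqP ->|/les//]; exact: pair_of_le.
rewrite -mulr_suml -mulr_sumr exprS -!mulrA ler_wpM2l // mulrA ler_wpM2r ?exprn_ge0 //.
apply: le_trans (sum_trail_weight_le Abar theta x s HA t0) _.
rewrite mulrC ler_wpM2l ?lerD2r ?ler_nat -?ss ?leq_addr ?trail_weight_ge0 //.
Qed.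

Lemma expect_trace_le {R : realType} {n} (Abar : 'M[R]_n) (theta : R) p :
  edge_prob_matrix Abar -> 0 < theta <= 1 ->
  expect Abar (fun w => \tr ((adjmx R w - Abar) ^+ p.*2))
  <= n%:R * (theta^-1 * (p.*2%:R + theta * dmax Abar) ^+ 2) ^+ p.
Proof.
move=> HA Ht; rewrite /expect /mxtrace.
under eq_bigr do rewrite mulr_sumr.
rewrite exchange_big /= mulr_natl -[X in _ <= _ *+ X]card_ord -sumr_const.
apply: ler_sum => x _; rewrite exprMn -exprM mul2n.
have := @expect_walk_le R n Abar theta p p.*2 [::] x x HA Ht erefl.
move=> /(_ (fun e H => ltac:(by []))); rewrite /trail_weight big_nil mulr1.
by apply: le_trans; apply: ler_sum => w _; rewrite big_nil mul1r.
Qed.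

(** Markov's inequality for the nonnegative [f]: outside [E] its value exceeds [t]. *)
Lemma prob_graph_ge {R : realType} {n} (Abar : 'M[R]_n) (E : 'M[R]_n -> Prop)
    (f : 'M[R]_n -> R) (t delta : R) :
  edge_prob_matrix Abar -> 0 < t -> (forall w, 0 <= f (adjmx R w)) ->
  (forall w, f (adjmx R w) <= t -> E (adjmx R w)) ->
  expect Abar (fun w => f (adjmx R w)) <= delta * t ->
  1 - delta <= prob_graph Abar E.
Proof.
move=> HA t0 f0 fE Ef; rewrite lerBlDr -lerBlDl -(expect1 Abar) /expect /prob_graph.
rewrite (bigID (fun w => `[< E (adjmx R w) >])) /=.
under eq_bigr do rewrite mulr1; rewrite addrAC subrr add0r.
rewrite -(ler_pM2r t0) mulr_suml; apply: le_trans Ef.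
rewrite /expect [leRHS](bigID (fun w => `[< E (adjmx R w) >])) /= -[leLHS]add0r lerD //.
  by apply: sumr_ge0 => w _; rewrite mulr_ge0 // outcome_weight_ge0.
apply: ler_sum => w /asboolPn nE; rewrite mulr1 ler_wpM2l ?outcome_weight_ge0 //.
by rewrite leNgt; apply/negP => /ltW /fE.
Qed.

(** * Large-budget interventions *)

(** Split [u = c v + w] with [w] orthogonal to [v]. The form of [Abar] at [u] is at most
    [lam * (c ^+ 2 + kappa * (1 - c ^+ 2))], whereas for [A] the value at [u] is at least that at
    [v]. Passing between the two matrices costs [eta] at each vector. *)
Lemma top_eigenvector_alignment {R : realType} {n} (Abar A : 'M[R]_n)
    (lam kappa eta mu : R) (v u : 'cV[R]_n) :
  Abar^T = Abar -> vnorm v = 1 -> Abar *m v = lam *: v -> 0 <= kappa * lam ->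
  inv_spectral_gap_le Abar lam kappa ->
  vnorm u = 1 -> A *m u = mu *: u ->
  (forall x, dotv x (A *m x) <= mu * sqnorm x) ->
  (forall x, vnorm x = 1 -> `|dotv x ((A - Abar) *m x)| <= eta) ->
  (1 - dotv u v ^+ 2) * ((1 - kappa) * lam) <= 2 * eta.
Proof.
move=> sA v1 Av kl0 gap u1 Au le_mu le_eta.
have sqv : sqnorm v = 1 by rewrite -vnorm_sqr v1 expr1n.
have squ : sqnorm u = 1 by rewrite -vnorm_sqr u1 expr1n.
pose c := dotv u v; pose w := u - c *: v.
have vw : dotv v w = 0 by rewrite dotvBr dotvZr dotvv sqv mulr1 dotvC subrr.
have uE : u = c *: v + w by rewrite addrC subrK.
clearbody w.
have sqw : sqnorm w = 1 - c ^+ 2.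
  by have := squ; rewrite {1}uE sqnormD sqnormZ sqv dotvZl vw => <-; ring.
have Aw : dotv v (Abar *m w) = 0 by rewrite dotv_mulmx sA Av dotvZl vw mulr0.
have formu : dotv u (Abar *m u) = c ^+ 2 * lam + dotv w (Abar *m w).
  rewrite uE mulmxDr -scalemxAr Av !dotvDl !dotvDr !dotvZl !dotvZr dotvv sqv Aw.
  by rewrite (dotvC w v) vw; ring.
have le_w : dotv w (Abar *m w) <= kappa * lam * (1 - c ^+ 2).
  by rewrite -sqw; apply: quadratic_form_orthogonal_le vw.
have := le_eta v v1; have := le_eta u u1.
rewrite !mulmxBl !dotvBr Av Au !dotvZr !dotvv sqv squ !mulr1 formu.
rewrite !ler_norml => /andP[_ le1] /andP[le2 _].
have := le_mu v; rewrite sqv mulr1 -/c; lra.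
Qed.

(** [1 - beta * mu] is the least eigenvalue of [M], attained at [u]. With [M z = x], the lower bound
    pairs [x] with [u]; the upper one pairs it with [z]. *)
Lemma Mgame_bounds {R : realType} {n} (beta mu : R) (A : 'M[R]_n) (u x : 'cV[R]_n) :
  A^T = A -> 0 < beta -> vnorm u = 1 -> A *m u = mu *: u ->
  (forall x, dotv x (A *m x) <= mu * sqnorm x) -> beta * mu < 1 ->
  dotv u x ^+ 2 <= (1 - beta * mu) ^+ 2 * sqnorm (invmx (Mgame beta A) *m x)
    <= sqnorm x.
Proof.
move=> sA beta0 u1 Au le_mu bmu.
have g0 : 0 < 1 - beta * mu by lra.
have squ : sqnorm u = 1 by rewrite -vnorm_sqr u1 expr1n.
set M := Mgame beta A; set g := 1 - _ in g0 *.
have sM : M^T = M by rewrite /M /Mgame linearB linearZ /= trmx1 sA.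
have Mu : M *m u = g *: u.
  by rewrite mulmxBl mul1mx -scalemxAl Au scalerA -{1}[u]scale1r -scalerBl.
have coercive z : g * sqnorm z <= dotv z (M *m z).
  rewrite mulmxBl mul1mx -scalemxAl dotvBr dotvZr dotvv.
  have := ler_wpM2l (ltW beta0) (le_mu z); rewrite /g; lra.
(* [invmx] is a genuine inverse only on units; coercivity makes the kernel trivial. *)
have Munit : M \in unitmx.
  rewrite -row_free_unit; apply: inj_row_free => z zM.
  have Mz : M *m z^T = 0 by rewrite -sM -trmx_mul zM trmx0.
  have := coercive z^T; rewrite Mz dotv0 pmulr_rle0 // => z0.
  have : sqnorm z^T == 0 by rewrite eq_le z0 sqnorm_ge0.
  by rewrite sqnorm_eq0 trmx_eq0 => /eqP.
set z := invmx M *m x; have Mz : M *m z = x by rewrite mulmxA mulmxV ?mul1mx.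
apply/andP; split.
  rewrite -Mz dotv_mulmx sM Mu dotvZl exprMn ler_wpM2l ?sqr_ge0 //.
  by apply: le_trans (cauchy_schwarz _ _) _; rewrite squ mul1r.
rewrite -vnorm_sqr -exprMn -vnorm_sqr ler_pXn2r ?nnegrE ?mulr_ge0 ?vnorm_ge0 ?(ltW g0) //.
have [z0|zp] := leP (vnorm z) 0.
  by apply: le_trans (vnorm_ge0 x); rewrite pmulr_rle0.
rewrite -(ler_pM2r zp) -mulrA -expr2 vnorm_sqr; apply: le_trans (coercive z) _.
by rewrite Mz mulrC; apply: le_trans (ler_norm _) (dotv_le_vnorm _ _).
Qed.

(** Both welfares are bounded with the same factor [(1 - beta * mu) ^+ 2], which cancels. What
    remains compares [q * c - N] with [q + N], where [b] enters only through its norm [N]. *)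
Lemma competitive_ratio_large_budget {R : realType} {n} (beta mu eps : R)
    (A : 'M[R]_n) (b u v : 'cV[R]_n) :
  A^T = A -> 0 < beta -> vnorm u = 1 -> A *m u = mu *: u ->
  (forall x, dotv x (A *m x) <= mu * sqnorm x) -> beta * mu < 1 ->
  vnorm v = 1 -> eps < 1 -> 1 - eps < dotv u v ^+ 2 ->
  exists C0 : R, forall C : R, C0 <= C ->
    forall ystar : 'cV[R]_n, optimal_intervention beta A b C ystar ->
      competitive_ratio beta A b (Num.sqrt C *: v) ystar >= 1 - eps.
Proof.
move=> sA beta0 u1 Au le_mu bmu v1 eps1 lt_c.
pose c : R := `|dotv u v|; pose s : R := Num.sqrt (1 - eps); pose N := vnorm b.
have N0 : 0 <= N := vnorm_ge0 b.
have s0 : 0 <= s := sqrtr_ge0 _.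
have s2 : s ^+ 2 = 1 - eps by rewrite sqr_sqrtr // subr_ge0 ltW.
have c0 : 0 <= c := normr_ge0 _.
have sc : s < c.
  by rewrite -(@ltr_pXn2r _ 2) ?nnegrE // s2 real_normK ?num_real.
(* Chosen so that [q >= K] gives [s * (q + N) <= q * c - N] with slack [c - s]; the slack makes the
   lower bound, hence the welfare, strictly positive. *)
pose K := 1 + (1 + s) * N / (c - s).
have csp : 0 < c - s by rewrite subr_gt0.
have K0 : 0 < K by rewrite ltr_pwDl // divr_ge0 ?(ltW csp) // mulr_ge0 // addr_ge0.
exists (K ^+ 2) => C leC ystar [ystarC opt].
set q := Num.sqrt C; have Kq : K <= q by rewrite -[K]gtr0_norm // -sqrtr_sqr ler_wsqrtr.
have q0 : 0 <= q := sqrtr_ge0 _.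
have Kc : K * (c - s) = (c - s) + (1 + s) * N.
  by rewrite mulrDl mul1r divfK // gt_eqF.
have main : s * (q + N) + (c - s) <= q * c - N.
  have : K * (c - s) <= q * (c - s) by rewrite ler_wpM2r // ltW.
  rewrite Kc; lra.
set y := q *: v.
have yq : vnorm y = q.
  by rewrite /vnorm sqnormZ -vnorm_sqr v1 expr1n mulr1 sqrtr_sqr ger0_norm.
have lbound : q * c - N <= `|dotv u (b + y)|.
  have := dotv_le_vnorm u b; rewrite u1 mul1r -/N => le_b.
  have := lerB_normD (q * dotv u v) (dotv u b).
  by rewrite normrM (ger0_norm q0) -/c dotvDr dotvZr (addrC (dotv u b)); lra.
have ubound : sqnorm (b + ystar) <= (q + N) ^+ 2.
  rewrite -vnorm_sqr ler_pXn2r ?nnegrE ?vnorm_ge0 ?addr_ge0 //.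
  by apply: le_trans (vnormD _ _) _; rewrite ystarC addrC.
have g0 : 0 < (1 - beta * mu) ^+ 2 by rewrite exprn_gt0 //; lra.
set g2 := (1 - beta * mu) ^+ 2 in g0.
have /andP[lo _] := Mgame_bounds beta mu A u (b + y) sA beta0 u1 Au le_mu bmu.
have /andP[_ hi] := Mgame_bounds beta mu A u (b + ystar) sA beta0 u1 Au le_mu bmu.
rewrite -/g2 in lo hi.
have posL : 0 < s * (q + N) + (c - s).
  by rewrite ltr_wpDl // mulr_ge0 // addr_ge0.
have sq_le : (s * (q + N) + (c - s)) ^+ 2 <= dotv u (b + y) ^+ 2.
  rewrite -[leRHS]real_normK ?num_real // ler_pXn2r ?nnegrE ?(ltW posL) //.
  exact: le_trans main lbound.
have Wy : 0 < welfare beta A b y.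
  rewrite /welfare mulr_gt0 ?divr_gt0 // -(pmulr_rgt0 _ g0).
  by apply: lt_le_trans lo; apply: lt_le_trans sq_le; rewrite exprn_gt0.
have Wstar : 0 < welfare beta A b ystar by apply: lt_le_trans Wy _; exact: opt.
rewrite /competitive_ratio ler_pdivlMr // /welfare mulrCA ler_wpM2l ?divr_ge0 //.
rewrite -(ler_pM2l g0) mulrCA; apply: le_trans lo; apply: le_trans sq_le.
apply: (@le_trans _ _ ((s * (q + N)) ^+ 2)).
  rewrite exprMn s2 ler_wpM2l ?subr_ge0 ?(ltW eps1) //; exact: le_trans ubound.
by rewrite ler_pXn2r ?nnegrE ?(ltW posL) ?mulr_ge0 ?addr_ge0 // lerDl subr_ge0 ltW.
Qed.

(** * Numerical estimates and the final probability bound *)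

Lemma exists_pow2_between {R : realType} (L : R) : 2^-1 <= L ->
  exists k, L <= (2 ^ k)%:R <= 4 * L.
Proof.
move=> L2; have L0 : 0 <= L by lra.
have ex : exists k, L <= (2 ^ k)%:R.
  exists (Num.bound L); apply: le_trans (ltW (archi_boundP L0)) _.
  by rewrite ler_nat ltnW // ltn_expl.
(* For the least exponent, half the power is below [L]; at exponent zero, [1 <= 4 * L] comes from
   [L >= 1 / 2]. *)
case: (ex_minnP ex) => -[|k] Lk mink; [exists 0%N|exists k.+1]; rewrite Lk /=.
  by rewrite expn0; lra.
rewrite expnS natrM; have : (2 ^ k)%:R < L; last lra.
by rewrite ltNge; apply/negP => /mink; rewrite ltnn.
Qed.

Lemma ln2_ge_half {R : realType} : 2^-1 <= ln 2 :> R.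
Proof.
rewrite [X in ln X](_ : 2 = (1 - 2^-1)^-1); last by field.
rewrite lnV ?posrE; last lra.
by rewrite lerNr le_ln1Dx //; lra.
Qed.

Lemma expR1_le4 {R : realType} : expR 1 <= 4 :> R.
Proof.
have h : expR 2^-1 <= 2 :> R by rewrite -[leRHS]lnK ?posrE // ler_expR ln2_ge_half.
rewrite [X in expR X](_ : 1 = 2^-1 + 2^-1); last by field.
have := expR_ge0 (2^-1 : R); rewrite expRD; nra.
Qed.

Lemma adjmx_sym (R : realType) {n} (w : outcome n) : (adjmx R w)^T = adjmx R w.
Proof.
apply/matrixP => i j; rewrite !mxE; case: (ltngtP i j) => //= ij.
by have -> : i = j by exact: val_inj.
Qed.

Lemma concentration_numerics {R : realType} (n : nat) (delta d L : R) p :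
  0 < n%:R :> R -> 0 < delta -> expR L = 2 * n%:R / delta -> 0 < L ->
  4 / 9 * L <= d -> L <= p%:R <= 4 * L ->
  n%:R * ((4 / 9 * L / d)^-1 * (p.*2%:R + 4 / 9 * L / d * d) ^+ 2) ^+ p
    <= delta * (1024 * (d * L)) ^+ p.
Proof.
move=> n0 delta0 eL L0 Ld /andP[Lp p4L].
have d0 : 0 < d by lra.
have dL0 : 0 < d * L by rewrite mulr_gt0.
rewrite divfK ?gt_eqF // -mul2n natrM.
set X := _^-1 * _.
have X0 : 0 <= X by rewrite mulr_ge0 ?sqr_ge0 // invr_ge0 divr_ge0 //; lra.
have Xle : 4 * X <= 1024 * (d * L).
  have -> : X = 9 / 4 * d / L * (2 * p%:R + 4 / 9 * L) ^+ 2.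
    by rewrite /X; field; rewrite !gt_eqF.
  (* Since [p <= 4 * L], the base is at most [(8 + 4 / 9) * L]. The constant becomes
     [4 * (9 / 4) * 81 = 729], below 1024. *)
  have sq : (2 * p%:R + 4 / 9 * L) ^+ 2 <= (9 * L) ^+ 2.
    by rewrite ler_pXn2r ?nnegrE //; lra.
  have c0 : 0 <= 9 / 4 * d / L by rewrite divr_ge0 //; lra.
  apply: (@le_trans _ _ (4 * (9 / 4 * d / L * (9 * L) ^+ 2))).
    by rewrite ler_wpM2l // ler_wpM2l.
  have -> : 4 * (9 / 4 * d / L * (9 * L) ^+ 2) = 729 * (d * L).
    by field; rewrite gt_eqF.
  lra.
(* The factor 4 kept in [Xle] pays for [expR L <= expR 1 ^+ p], and [expR L] in turn absorbs
   [n / delta]. *)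
clearbody X; have eX : expR L * X ^+ p <= (1024 * (d * L)) ^+ p.
  apply: (@le_trans _ _ ((expR 1 * X) ^+ p)).
    rewrite exprMn ler_wpM2r ?exprn_ge0 // -expRM_natl mulr1 ler_expR //.
  apply: lerXn2r; rewrite ?nnegrE ?mulr_ge0 ?expR_ge0 ?(ltW d0) ?(ltW L0) //.
  by apply: le_trans Xle; rewrite ler_wpM2r ?expR1_le4.
apply: le_trans (_ : delta * (expR L * X ^+ p) <= _); last by rewrite ler_wpM2l // ltW.
have -> : delta * (expR L * X ^+ p) = 2 * (n%:R * X ^+ p).
  by rewrite eL; field; rewrite gt_eqF.
have nX : 0 <= n%:R * X ^+ p by rewrite mulr_ge0 ?exprn_ge0 // ltW.
lra.
Qed.

Theorem theorem1 (R : realType) (n : nat) (Abar : 'M[R]_n)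
    (lam1 : R) (v1 : 'cV[R]_n) (eps delta beta : R) (b : 'cV[R]_n) :
  edge_prob_matrix Abar ->
  top_eigenpair Abar lam1 v1 ->
  0 < eps < 1 -> 0 < delta < 1 ->
  concentration Abar lam1 eps delta ->
  0 < beta ->
  (forall i, 0 <= b i 0) ->
  prob_graph Abar (fun A =>
    spectral_radius_lt A (1 / beta) ->
    exists C0 : R, forall C : R, C0 <= C ->
      forall ystar : 'cV[R]_n, optimal_intervention beta A b C ystar ->
        competitive_ratio beta A b (Num.sqrt C *: v1) ystar >= 1 - eps)
  >= 1 - delta.
Proof.
move=> HA [Av [v1n _]] /andP[eps0 eps1] /andP[delta0 delta1] [Ld conc] beta0 _.
have [sA _] := HA; case: conc => kappa [kappa0 [kappa1 [gap big]]].
have n0 : (0 < n)%N.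
  case: n v1 v1n {Abar HA Av Ld gap big sA b} => // v /eqP.
  by rewrite /vnorm /sqnorm big_ord0 sqrtr0 eq_sym oner_eq0.
have n1 : 1 <= n%:R :> R by rewrite ler1n.
have arg2 : 2 <= 2 * n%:R / delta.
  by rewrite ler_pdivlMr //; nra.
set L := ln _ in Ld big; set d := dmax _ in Ld big.
have L2 : 2^-1 <= L.
  by apply: le_trans ln2_ge_half _; rewrite ler_ln ?posrE //; apply: lt_le_trans arg2.
have L0 : 0 < L by lra.
have eL : expR L = 2 * n%:R / delta by rewrite lnK // posrE; apply: lt_le_trans arg2.
have d0 : 0 < d by lra.
have dL0 : 0 < d * L by rewrite mulr_gt0.
set S := Num.sqrt _ in big; have S0 : 0 < S by rewrite sqrtr_gt0.
have S2 : S ^+ 2 = d * L by rewrite sqr_sqrtr // ltW.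
have [k /andP[Lk kL]] := exists_pow2_between L L2.
(* A power of two, as [quadratic_form_le_trace] requires. *)
pose p := (2 ^ k)%N; have p2 : (2 ^ k.+1 = p.*2)%N by rewrite expnS mul2n.
pose eta := 32 * S; have eta0 : 0 < eta by rewrite mulr_gt0.
have etaE : eta ^+ p.*2 = (1024 * (d * L)) ^+ p.
  by rewrite -mul2n exprM; congr (_ ^+ _); rewrite -S2 /eta; ring.
(* Makes [theta * d] of order [L]; the lower bound on the maximum expected degree says exactly that
   [theta <= 1]. *)
pose theta := 4 / 9 * L / d.
have theta01 : 0 < theta <= 1.
  by rewrite /theta ler_pdivrMr // mul1r Ld andbT divr_gt0 //; lra.
have sB A : A^T = A -> (A - Abar)^T = A - Abar by move=> s; rewrite linearB /= s sA.
have form_le A x : A^T = A -> vnorm x = 1 ->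
    dotv x ((A - Abar) *m x) ^+ p.*2 <= \tr ((A - Abar) ^+ p.*2).
  by move=> s x1; rewrite -p2; apply: quadratic_form_le_trace => //; exact: sB.
apply: (@prob_graph_ge R n Abar _ (fun A => \tr ((A - Abar) ^+ p.*2)) (eta ^+ p.*2)) => //.
- by rewrite exprn_gt0.
- move=> w; apply: le_trans (form_le _ v1 (adjmx_sym R w) v1n).
  by rewrite -mul2n exprM exprn_ge0 // sqr_ge0.
- move=> w; have sAA := adjmx_sym R w; move: (adjmx R w) sAA => A sAA le_tr.
  have le_eta x : vnorm x = 1 -> `|dotv x ((A - Abar) *m x)| <= eta.
    move=> x1; have p0 : (0 < p.*2)%N by rewrite double_gt0 expn_gt0.
    rewrite -(ler_pXn2r p0) ?nnegrE ?(ltW eta0) //.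
    apply: le_trans le_tr; apply: le_trans (form_le A x sAA x1).
    by rewrite -mul2n !exprM real_normK ?num_real.
  move=> radius.
  have [u [mu [u1 Au le_mu]]] := rayleigh_max A n0 sAA.
  have bmu : beta * mu < 1.
    have u0 : u != 0 by rewrite -sqnorm_eq0 -vnorm_sqr u1 expr1n oner_eq0.
    have := le_lt_trans (ler_norm _) (radius mu u u0 Au).
    by rewrite ltr_pdivlMr // mulrC.
  have gapE : lam1 * (1 - kappa ^+ 2) = ((1 - kappa) * lam1) * (1 + kappa) by ring.
  have eps2 : 0 < eps ^+ 2 by rewrite exprn_gt0.
  rewrite gapE ler_pdivrMr // in big.
  have gl0 : 0 < (1 - kappa) * lam1.
    have : 0 < (1 - kappa) * lam1 * (1 + kappa) * eps ^+ 2.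
      by apply: lt_le_trans big; rewrite mulr_gt0.
    by rewrite pmulr_lgt0 // pmulr_lgt0 //; lra.
  have lam0 : 0 < lam1 by move: gl0; rewrite pmulr_rgt0 // subr_gt0.
  apply: (@competitive_ratio_large_budget R n beta mu eps A b u v1) => //.
  have := @top_eigenvector_alignment R n Abar A lam1 kappa eta mu v1 u sA v1n Av
    (mulr_ge0 kappa0 (ltW lam0)) gap u1 Au le_mu le_eta.
  set c2 := dotv u v1 ^+ 2 => align.
  (* If [c2 <= 1 - eps], alignment gives [eps * (1 - kappa) * lam1 <= 64 * S]. As
     [(1 + kappa) * eps <= 2], the left side of [big] is then at most [128 * S], against the
     required [1024 * S]. *)
  rewrite ltNge; apply/negP => c2le.
  have : eps * ((1 - kappa) * lam1) <= 64 * S.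
    apply: le_trans (_ : 2 * eta <= _); last by rewrite /eta; lra.
    by apply: le_trans align; rewrite ler_wpM2r ?(ltW gl0) //; lra.
  have : (1 - kappa) * lam1 * (1 + kappa) * eps ^+ 2
      <= (eps * ((1 - kappa) * lam1)) * 2.
    rewrite [leLHS](_ : _ = (eps * ((1 - kappa) * lam1)) * ((1 + kappa) * eps)); last ring.
    by rewrite ler_wpM2l ?mulr_ge0 ?(ltW eps0) ?(ltW gl0) //; nra.
  lra.
- apply: le_trans (expect_trace_le Abar theta p HA theta01) _.
  rewrite etaE -/d; apply: concentration_numerics => //; last exact/andP.
  by lra.
Qed.
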